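(* Let $p$ be a prime number, let $k$ be a natural number with $2^{k}<p$, and let $(A,+,\circ)$ be an $\mathbb{F}_{p}$-brace which is strongly nilpotent of degree $k$. Write $a*b=a\circ b-a-b$, and define a binary operation $\cdot$ on $A$ by $$a\cdot b=\sum_{i=0}^{p-2}\frac{1}{2^{i}}\bigl((2^{i}a)*b\bigr)\qquad (a,b\in A),$$ where $2^{i}a$ denotes the sum of $2^{i}$ copies of $a$ and $\frac1{2^{i}}$ denotes the inverse of $2^{i}$ in $\mathbb{F}_{p}$. Define $a\odot b=-(a\cdot b)$. Then $A$ with the operations $+$ and $\odot$ is a pre-Lie algebra over the field $\mathbb{F}_{p}$.
   Context: A left brace is a set $A$ with operations $+,\circ$ such that $(A,+)$ is an abelian group, $(A,\circ)$ is a group, and $a\circ(b+c)+a=a\circ b+a\circ c$ for all $a,b,c\in A$. One writes $a*b=a\circ b-a-b$. For a field $\mathbb{F}$, an $\mathbb{F}$-brace is a left brace whose additive group is an $\mathbb{F}$-vector space with $a*(\alpha b)=\alpha(a*b)$ for all $a,b\in A$, $\alpha\in\mathbb{F}$. $\mathbb{F}_p$ is the field with $p$ elements. For subsets $X,Y\subseteq A$, $X*Y$ denotes the set of all finite sums of elements $x*y$, $x\in X$, $y\in Y$. Put $A^{[1]}=A$ and $A^{[i+1]}=\sum_{j=1}^{i}A^{[j]}*A^{[i+1-j]}$. The brace $A$ is strongly nilpotent if $A^{[n]}=0$ for some $n$; it is strongly nilpotent of degree $k$ (equivalently, has nilpotency index $k$) if $A^{[k]}=0$ and $A^{[k-1]}\neq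 0$. A pre-Lie algebra over a field is a vector space with a bilinear operation $(x,y)\mapsto xy$ satisfying $(xy)z-x(yz)=(yx)z-y(xz)$ for all $x,y,z$. *)

(* Defs.v *)
From HB Require Import structures.
From mathcomp Require Import all_boot all_algebra.

Set Implicit Arguments.
Unset Strict Implicit.
Unset Printing Implicit Defensive.

Import GRing.Theory.
Local Open Scope ring_scope.

(* The multiplicative group of a brace is the library's [groupType] structure
   on the carrier: a o b is [(a * b)%g], while + is the [zmodType] addition. *)
HB.mixin Record Zmodule_Group_isLeftBrace A of GRing.Zmodule A & Group A := {
  brace_distr : forall a b c : A,
    (a * (b + c))%g + a = (a * b)%g + (a * c)%g
}.

#[short(type="leftBraceType")]
HB.structure Definition LeftBrace :=
  {A of GRing.Zmodule A & Group A & Zmodule_Group_isLeftBrace A}.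

Definition brace_star (A : leftBraceType) (a b : A) : A := (a * b)%g - a - b.

HB.mixin Record LeftBrace_isFBrace (F : fieldType) A
    of LeftBrace A & GRing.Lmodule F A := {
  brace_starZr : forall (c : F) (a b : A),
    brace_star a (c *: b) = c *: brace_star a b
}.

#[short(type="fBraceType")]
HB.structure Definition FBrace (F : fieldType) :=
  {A of LeftBrace A & GRing.Lmodule F A & LeftBrace_isFBrace F A}.

Section StrongNilpotency.

Variable A : leftBraceType.
Implicit Types (X Y : A -> Prop) (a : A).

Definition star_set X Y : A -> Prop := fun a =>
  exists2 s : seq (A * A), (forall u, u \in s -> X u.1 /\ Y u.2)
                         & a = \sum_(u <- s) brace_star u.1 u.2.

Definition sum_sets (n : nat) (S : 'I_n -> A -> Prop) : A -> Prop := fun a =>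
  exists2 f : 'I_n -> A, (forall j, S j (f j)) & a = \sum_j f j.

(* [strong_pows n] lists A^[1], ..., A^[n+1]; its j-th entry is A^[j+1]. *)
Fixpoint strong_pows (n : nat) : seq (A -> Prop) :=
  if n is m.+1 then
    let s := strong_pows m in
    rcons s (sum_sets (fun j : 'I_m.+1 =>
      star_set (nth (fun _ => True) s j) (nth (fun _ => True) s (m - j))))
  else [:: fun _ => True].

(* A^[n] for n >= 1; the value at n = 0 is junk. *)
Definition strong_pow (n : nat) : A -> Prop :=
  nth (fun _ => True) (strong_pows n.-1) n.-1.

Lemma size_strong_pows n : size (strong_pows n) = n.+1.
Proof. by elim: n => //= n IHn; rewrite size_rcons IHn. Qed.

Lemma nth_strong_pows n j : (j <= n)%N ->
  nth (fun _ => True) (strong_pows n) j = strong_pow j.+1.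
Proof.
elim: n => [|n IHn]; first by rewrite leqn0 => /eqP->.
rewrite leq_eqVlt => /predU1P[-> //|ltjn].
by rewrite /= nth_rcons size_strong_pows ltjn IHn.
Qed.

Lemma strong_pow1 a : strong_pow 1 a.
Proof. by []. Qed.

(* The defining recursion A^[i+1] = \sum_(1 <= j <= i) A^[j] * A^[i+1-j],
   with j shifted by one. *)
Lemma strong_powS i a : (0 < i)%N ->
  strong_pow i.+1 a <->
  sum_sets (fun j : 'I_i => star_set (strong_pow j.+1) (strong_pow (i - j))) a.
Proof.
case: i => // m _.
have -> : strong_pow m.+2 = sum_sets (fun j : 'I_m.+1 =>
    star_set (nth (fun _ => True) (strong_pows m) j)
             (nth (fun _ => True) (strong_pows m) (m - j))).
  by rewrite {1}/strong_pow /= nth_rcons size_strong_pows ltnn eqxx.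
have powl (j : 'I_m.+1) :
    nth (fun _ => True) (strong_pows m) j = strong_pow j.+1.
  by apply: nth_strong_pows; rewrite -ltnS.
have powr (j : 'I_m.+1) :
    nth (fun _ => True) (strong_pows m) (m - j) = strong_pow (m.+1 - j).
  by rewrite nth_strong_pows ?leq_subr // subSn // -ltnS.
by split=> -[f fP ->]; exists f => // j; move: (fP j); rewrite powl powr.
Qed.

Definition is_zero_set X : Prop := forall a, X a <-> a = 0.

(* A^[0] is not defined, so for k = 1 only A^[1] = 0 is required: the zero
   brace has degree 1. *)
Definition strongly_nilpotent_of_degree (k : nat) : Prop :=
  [/\ (0 < k)%N, is_zero_set (strong_pow k)
    & (1 < k)%N -> ~ is_zero_set (strong_pow k.-1)].

End StrongNilpotency.

Definition pre_lie_algebra (F : fieldType) (V : lmodType F) (op : V -> V -> V)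
    : Prop :=
  [/\ forall y, linear (fun x => op x y),
      forall x, linear (op x)
    & forall x y z, op (op x y) z - op x (op y z) =
                    op (op y x) z - op y (op x z)].

Definition brace_dot (p : nat) (A : fBraceType 'F_p) (a b : A) : A :=
  \sum_(0 <= i < p.-1) ((2 ^ i)%N%:R : 'F_p)^-1 *: brace_star (a *+ (2 ^ i)) b.

Definition brace_odot (p : nat) (A : fBraceType 'F_p) (a b : A) : A :=
  - brace_dot a b.

(* Main.v *)
From HB Require Import structures.
Require Import Defs.
From mathcomp Require Import all_boot all_algebra all_field.
From mathcomp Require Import zify.

(** Write [lam a b = a o b - a], so that [lam] is a linear action of [(A, o)]
    and [a * b = lam a b - b].  The idea is that [t |-> (t a) * b], although
    defined only for [t] in F_p, is given by a polynomial in [t] of degree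
    [< k] without constant term; its linear coefficient is [a (.) b], and the
    pre-Lie law is what the group law of [o] leaves at first order.

    Polynomiality ([wpoly_raises]).  A function [u : F_p -> A] is said to be
    weighted ([wpoly i n u]) if it is a sum of monomials [t^m x] with [m >= n]
    and [x] in both [A^[i]] and [A^[m]].  Strong nilpotency then leaves
    only exponents [m < k], and the claim is that weighted functions are stable
    under [*].  This goes by descending induction on [i].  The functions [u]
    that satisfy the claim form a group under [o]; since [u + v] and [u o v]
    differ by [u * v], which has larger weight, they also form a group under
    [+], and one is left with [t^m x].  For these, compare the multiple
    [n x], [n = t^m], with the circle power [x^(o n)]: the latter acts as
    [(1 + x * _)^n = \sum_r 'C(n, r) (x * _)^r], which is polynomial in [n]
    because [r < k < p] makes [r!] invertible, and the quotient of the two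
    again has larger weight.

    Extraction of the linear coefficient ([lin_coef_mono]).  On [t^m x] the
    operator [- \sum_i 2^-i u(2^i)] is a geometric sum of ratio [2^(m-1)] with
    [p - 1] terms.  It vanishes unless [2^(m-1) = 1] in F_p, and [2^k < p]
    excludes this for [m < k] other than [m = 1], where the value is
    [- (p - 1) x = x].  Hence [a (.) b] is the linear coefficient of [(t a) * b].

    Infinitesimal calculus.  Products of two functions without constant term
    have no linear coefficient, so [u, v |-> u + v] and [u, v |-> u o v] agree
    to first order.  This makes [(.)] additive on the left and gives a chain
    rule ([lin_coef_star_cst]) and a product rule ([lin_coef_star]).
    Differentiating at [s = 0] the identity
    [lam (s a) (lam b c) = lam b (lam (b^-1 o (s a) o b) c)] yields
    [a (.) lam b c = lam b ((lam b^-1 (a + a (.) b)) (.) c)] ([brace_odot_conj]);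
    putting [t b] for [b] and differentiating at [t = 0] yields
    [a (.) (b (.) c) = b (.) (a (.) c) + (a (.) b - b (.) a) (.) c], which is
    the pre-Lie identity. *)

Set Implicit Arguments.
Unset Strict Implicit.
Unset Printing Implicit Defensive.

Import GRing.Theory.
Local Open Scope ring_scope.

(** * The action lambda of a brace, and circle powers *)

Definition brace_lam (A : leftBraceType) (a b : A) : A := (a * b)%g - a.

Section BraceAlgebra.

Variables (F : fieldType) (A : fBraceType F).
Implicit Types a b c x y : A.

Local Notation star := (@brace_star A).
Local Notation lam := (@brace_lam A).

Lemma brace_starDr a b c : star a (b + c) = star a b + star a c.
Proof.
have /(canRL (addrK _)) E := brace_distr a b c.
by rewrite /brace_star E [RHS]addrACA [in RHS](addrACA _ (- a)) !opprD !addrA.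
Qed.

Lemma brace_star_is_linear a : linear (star a).
Proof. by move=> c x y; rewrite brace_starDr brace_starZr. Qed.

HB.instance Definition _ a :=
  GRing.isLinear.Build F A A *:%R (star a) (brace_star_is_linear a).

Lemma brace_lamE a b : lam a b = star a b + b.
Proof. by rewrite /brace_star subrK. Qed.

Lemma brace_lam_is_linear a : linear (lam a).
Proof.
by move=> c x y; rewrite !brace_lamE linearP scalerDr addrACA.
Qed.

HB.instance Definition _ a :=
  GRing.isLinear.Build F A A *:%R (lam a) (brace_lam_is_linear a).

Lemma brace_mulE a b : (a * b)%g = a + lam a b.
Proof. by rewrite addrC subrK. Qed.

Lemma brace_mulg0 a : (a * 0)%g = a.
Proof. by rewrite brace_mulE linear0 addr0. Qed.

Lemma brace1 : (1%g : A) = 0.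
Proof. by rewrite -[RHS]mul1g brace_mulg0. Qed.

Lemma brace_lam1 b : lam 1%g b = b.
Proof. by rewrite /brace_lam mul1g brace1 subr0. Qed.

Lemma brace_lamM a b c : lam (a * b)%g c = lam a (lam b c).
Proof.
apply: (addrI (a * b)%g); rewrite -brace_mulE -mulgA (brace_mulE a (b * c)%g).
rewrite (brace_mulE b c) linearD /= addrA.
by rewrite -(brace_mulE a b).
Qed.

Lemma brace_lamK a : cancel (lam a) (lam a^-1%g).
Proof. by move=> b; rewrite -brace_lamM mulVg brace_lam1. Qed.

Lemma brace_lamVK a : cancel (lam a^-1%g) (lam a).
Proof. by move=> b; rewrite -brace_lamM mulgV brace_lam1. Qed.

Lemma brace_star0l b : star 0 b = 0.
Proof. by rewrite /brace_star -brace1 mul1g brace1 subr0 subrr. Qed.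

Lemma brace_starM a b c :
  star (a * b)%g c = star a (star b c) + star a c + star b c.
Proof.
by apply: (addIr c); rewrite -brace_lamE brace_lamM !brace_lamE linearD -!addrA.
Qed.

Lemma brace_mulVg_lam x y : (x^-1 * y)%g = lam x^-1%g (y - x).
Proof.
have /eqP := mulVg x; rewrite brace1 brace_mulE addr_eq0 => /eqP E.
by rewrite brace_mulE linearB /= -E addrC.
Qed.

Lemma brace_mulB a b : a + b - (a * b)%g = - star a b.
Proof. by rewrite /brace_star -[in RHS]addrA -opprD opprB. Qed.

(** This is the binomial expansion of [(1 + L)^n] for [L = brace_star a].
    The bound [K] on the range is independent of [n], which is what turns the
    right-hand side into a polynomial in [n]. *)
Lemma iter_brace_lam K a n b : iter K (star a) b = 0 ->
  iter n (lam a) b = \sum_(r < K) iter r (star a) b *+ 'C(n, r).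
Proof.
move=> bK; elim: n => [|n IHn] /=.
  case: K bK => [|K] /= bK; first by rewrite big_ord0 bK.
  by rewrite big_ord_recl big1 /= ?addr0 // => r _; rewrite bin0n.
rewrite IHn brace_lamE linear_sum /=.
case: K bK {IHn} => [|K] bK; first by rewrite !big_ord0 addr0.
rewrite big_ord_recr [in X in _ + X]big_ord_recl [RHS]big_ord_recl !bin0 /=.
rewrite linearMn -iterS bK mul0rn addr0 addrCA; congr (_ + _).
rewrite -big_split /=; apply: eq_bigr => r _.
by rewrite binS mulrnDr linearMn addrC.
Qed.

Lemma brace_lamX a n b : lam (a ^+ n)%g b = iter n (lam a) b.
Proof. by elim: n => [|n IHn] /=; rewrite ?brace_lam1 // expgS brace_lamM IHn. Qed.

(** Telescoping [a^(o n) = \sum_(s < n) (lam a)^s a] sums the binomial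
    coefficients of [iter_brace_lam] along a diagonal. *)
Lemma brace_expE K a n : iter K (star a) a = 0 ->
  (a ^+ n)%g = \sum_(r < K) iter r (star a) a *+ 'C(n, r.+1).
Proof.
move=> aK; elim: n => [|n IHn].
  by rewrite big1 => [|r _]; rewrite ?bin0n // expg0 brace1.
rewrite expgSr brace_mulE brace_lamX (iter_brace_lam _ aK) IHn -big_split /=.
by apply: eq_bigr => r _; rewrite binS mulrnDr.
Qed.

End BraceAlgebra.

(** * The strong powers of an F-brace *)

Section Weights.

Variables (F : fieldType) (A : fBraceType F).
Implicit Types x y : A.

Lemma star_set0 (X Y : A -> Prop) : star_set X Y 0.
Proof. by exists [::]; rewrite ?big_nil. Qed.

Lemma strong_pow0 i : strong_pow i (0 : A).
Proof.
case: i => [|[|i]] //; apply/strong_powS => //.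
by exists (fun=> 0) => [j|]; [apply: star_set0 | rewrite big1].
Qed.

Lemma strong_powD i x y : strong_pow i x -> strong_pow i y -> strong_pow i (x + y).
Proof.
case: i => [|[|i]] // /strong_powS -[] // f fP -> /strong_powS -[] // g gP ->.
apply/strong_powS => //; exists (fun j => f j + g j); last by rewrite big_split.
move=> j; case: (fP j) (gP j) => s sP -> [s' s'P ->].
exists (s ++ s'); last by rewrite big_cat.
by move=> u; rewrite mem_cat => /orP[/sP|/s'P].
Qed.

Lemma strong_pow_sum i (I : Type) (r : seq I) (P : pred I) (f : I -> A) :
  (forall j, P j -> strong_pow i (f j)) -> strong_pow i (\sum_(j <- r | P j) f j).
Proof.
move=> fP; elim/big_ind: _ => //; [exact: strong_pow0 | exact: strong_powD].
Qed.

(** Hides the nested sums of [strong_powS]: it is the form in which the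
    inductions on the weight below use the definition. *)
Lemma strong_pow_ind (i : nat) (Q : A -> Prop) : (0 < i)%N ->
    Q 0 -> (forall x y, Q x -> Q y -> Q (x + y)) ->
    (forall m n x y, (0 < m)%N -> (0 < n)%N -> (m + n = i.+1)%N ->
       strong_pow m x -> strong_pow n y -> Q (brace_star x y)) ->
  forall x, strong_pow i.+1 x -> Q x.
Proof.
move=> i_gt0 Q0 QD Qstar _ /(strong_powS _ i_gt0)[f fP ->].
elim/big_ind: _ => // j _; case: (fP j) => s sP ->.
rewrite big_seq; elim/big_ind: _ => // u /sP[uX uY].
by apply: Qstar uX uY; have := ltn_ord j; lia.
Qed.

Lemma strong_pow_star_pos i j x y : (0 < i)%N -> (0 < j)%N ->
  strong_pow i x -> strong_pow j y -> strong_pow (i + j) (brace_star x y).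
Proof.
case: i j => // i [] // j _ _ xi yj; rewrite addSn addnS.
apply/strong_powS => //.
(* The summand of index [i] is [A^[i+1] * A^[j+1]]. *)
have lti : (i < (i + j).+1)%N by lia.
exists (fun m => if m == Ordinal lti then brace_star x y else 0).
  move=> m; case: eqP => [-> /=|_]; last exact: star_set0.
  exists [:: (x, y)]; rewrite ?big_seq1 // => u; rewrite inE => /eqP-> /=.
  by split=> //; rewrite (_ : (_ - _)%N = j.+1) //; lia.
by rewrite -big_mkcond big_pred1_eq.
Qed.

Lemma strong_powZ i (c : F) x : strong_pow i x -> strong_pow i (c *: x).
Proof.
elim/ltn_ind: i x => -[|[|i]] // IHi x.
move: x; apply: strong_pow_ind => //.
- by rewrite scaler0; apply: strong_pow0.
- by move=> x y Qx Qy; rewrite scalerDr; apply: strong_powD.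
move=> m n x y m_gt0 n_gt0 Emn xm yn; rewrite -linearZ -Emn.
by apply: strong_pow_star_pos => //; apply: IHi => //; lia.
Qed.

(** In a product of weight at least 3 one of the factors has weight at least 2,
    and that weight can be lowered by induction. *)
Lemma strong_powSW i x : strong_pow i.+1 x -> strong_pow i x.
Proof.
elim/ltn_ind: i x => -[|[|i]] // IHi x.
move: x; apply: strong_pow_ind => //; first exact: strong_pow0.
  by move=> x y; apply: strong_powD.
move=> [//|[|m]] n x y _ n_gt0 Emn xm yn.
  have En : n = i.+2 by lia.
  have ->: i.+2 = (1 + i.+1)%N by lia.
  by apply: strong_pow_star_pos => //; apply: IHi => //; rewrite -En.
have ->: i.+2 = (m.+1 + n)%N by lia.
by apply: strong_pow_star_pos => //; apply: IHi => //; lia.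
Qed.

Lemma strong_powW i j x : (j <= i)%N -> strong_pow i x -> strong_pow j x.
Proof.
move=> /subnK <-; elim: (i - j)%N => // d IHd; rewrite addSn => /strong_powSW.
exact: IHd.
Qed.

(** At weight 0 the predicate [strong_pow] holds everywhere, as at weight 1; zero
    weights therefore only weaken the claim. *)
Lemma strong_pow_star i j x y :
  strong_pow i x -> strong_pow j y -> strong_pow (i + j) (brace_star x y).
Proof.
move=> xi yj.
have x1 : strong_pow (maxn 1 i) x by case: (i) xi => [|[]].
have y1 : strong_pow (maxn 1 j) y by case: (j) yj => [|[]].
by apply: (strong_powW _ (strong_pow_star_pos _ _ x1 y1)); lia.
Qed.

Lemma strong_pow_iter_star i j r x y : strong_pow i x -> strong_pow j y ->
  strong_pow (r * i + j) (iter r (brace_star x) y).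
Proof.
by move=> xi yj; elim: r => //= r IHr; rewrite mulSn -addnA; apply: strong_pow_star.
Qed.

End Weights.

(** * Weighted polynomial functions *)

Section WeightedPolynomials.

Variables (F : fieldType) (A : fBraceType F).
Implicit Types (x y : A) (u v w : F -> A).

(** The index [i] bounds the weights, the index [n] the order at [t = 0].
    Generation by monomials makes no choice of coefficients, so that uniqueness of the coefficients of a
    polynomial function is never at stake.  The two indices are separate because
    the binomial coefficient ['C(t^m, r)] contains [t^m] as well as
    [t^(m r)]: it improves the weight of its coefficient but not the order. *)
Inductive wpoly (i n : nat) : (F -> A) -> Prop :=
| wpoly_mono m x : (n <= m)%N -> strong_pow i x -> strong_pow m x ->
    wpoly i n (fun t => t ^+ m *: x)
| wpolyD u v : wpoly i n u -> wpoly i n v -> wpoly i n (fun t => u t + v t)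
| wpoly_ext u v : wpoly i n u -> u =1 v -> wpoly i n v.

Lemma wpolyZ i n c u : wpoly i n u -> wpoly i n (fun t => c *: u t).
Proof.
elim=> [m x nm xi xm|v w _ IHv _ IHw|v w _ IHv Evw].
- apply: (wpoly_ext (wpoly_mono nm (strong_powZ c xi) (strong_powZ c xm))) => t.
  by rewrite !scalerA mulrC.
- by apply: (wpoly_ext (wpolyD IHv IHw)) => t; rewrite scalerDr.
by apply: (wpoly_ext IHv) => t; rewrite Evw.
Qed.

Lemma wpoly0 i n : wpoly i n (fun=> 0).
Proof.
apply: (wpoly_ext (wpoly_mono (leqnn n) (strong_pow0 A i) (strong_pow0 A n))) => t.
exact: scaler0.
Qed.

Lemma wpolyN i n u : wpoly i n u -> wpoly i n (fun t => - u t).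
Proof. by move/(wpolyZ (-1)) => H; apply: (wpoly_ext H) => t; rewrite scaleN1r. Qed.

Lemma wpolyB i n u v : wpoly i n u -> wpoly i n v -> wpoly i n (fun t => u t - v t).
Proof. by move=> uP /wpolyN; apply: wpolyD. Qed.

Lemma wpoly_sum i n (I : Type) (r : seq I) (u : I -> F -> A) :
  (forall j, wpoly i n (u j)) -> wpoly i n (fun t => \sum_(j <- r) u j t).
Proof.
move=> uP; elim: r => [|j r IHr].
  by apply: (wpoly_ext (wpoly0 i n)) => t; rewrite big_nil.
by apply: (wpoly_ext (wpolyD (uP j) IHr)) => t; rewrite big_cons.
Qed.

Lemma wpolyW i n j l u : (j <= i)%N -> (l <= n)%N -> wpoly i n u -> wpoly j l u.
Proof.
move=> ji ln; elim=> [m x nm xi xm|v w _ IHv _ IHw|v w _ IHv Evw].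
- by apply: wpoly_mono => //; [exact: leq_trans nm | exact: strong_powW xi].
- exact: wpolyD.
exact: wpoly_ext Evw.
Qed.

End WeightedPolynomials.

Section Raises.

Variables (F : fieldType) (A : fBraceType F).
Implicit Types (x y : A) (u v w : F -> A).

(** The property that [wpoly_raises] establishes for [wpoly i n u].  It is kept
    apart from [wpoly] because, unlike [wpoly], it is visibly stable under the
    circle product. *)
Definition raises i n u := forall j l v,
  wpoly j l v -> wpoly (i + j) (n + l) (fun t => brace_star (u t) (v t)).

Lemma raises_ext i n u v : raises i n u -> u =1 v -> raises i n v.
Proof.
move=> uR Euv j l w /uR wP; apply: (wpoly_ext wP) => t; by rewrite Euv.
Qed.

Lemma raisesW i n j l u : (j <= i)%N -> (l <= n)%N -> raises i n u -> raises j l u.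
Proof.
by move=> ji ln uR j' l' v /uR; apply: wpolyW; rewrite leq_add2r.
Qed.

(** Star is additive on the right, so monomials suffice there. *)
Lemma raises_mono i n u :
    (forall m x j, strong_pow j x -> strong_pow m x ->
      wpoly (i + j) (n + m) (fun t => brace_star (u t) (t ^+ m *: x))) ->
  raises i n u.
Proof.
move=> uR j l v; elim=> [m x lm xj xm|v1 v2 _ IH1 _ IH2|v1 v2 _ IH Ev].
- by apply: wpolyW (uR _ _ _ xj xm); rewrite // leq_add2l.
- by apply: (wpoly_ext (wpolyD IH1 IH2)) => t; rewrite linearD.
by apply: (wpoly_ext IH) => t; rewrite Ev.
Qed.

(** From [(u o v) * w = u * (v * w) + u * w + v * w]; the first term has at least
    the weight and the order of the second. *)
Lemma raisesM i n u v :
  raises i n u -> raises i n v -> raises i n (fun t => (u t * v t)%g).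
Proof.
move=> uR vR j l w wP; have vwP := vR _ _ _ wP.
have uvwP : wpoly (i + j) (n + l) (fun t => brace_star (u t) (brace_star (v t) (w t))).
  by apply: wpolyW (uR _ _ _ vwP); rewrite leq_add2l leq_addl.
apply: (wpoly_ext (wpolyD (wpolyD uvwP (uR _ _ _ wP)) vwP)) => t.
by rewrite brace_starM.
Qed.

Variables (k : nat).
Hypothesis Ak : forall x : A, strong_pow k x -> x = 0.

Lemma wpoly_eq0 i n u : (k <= i)%N -> wpoly i n u -> u =1 fun=> 0.
Proof.
move=> ki; elim=> [m x nm xi xm t|v w _ IHv _ IHw t|v w _ IHv Evw t].
- by rewrite (Ak (strong_powW ki xi)) scaler0.
- by rewrite IHv IHw addr0.
by rewrite -Evw.
Qed.

(** The function [x = lam u^-1 v] solves [x = v - lam u^-1 (u * v)], where [u * v]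
    has weight [i + j > j].  Iterating this reaches weight [k], where everything
    vanishes. *)
Lemma raises_lamV i n u j l v : (0 < i)%N -> raises i n u -> wpoly j l v ->
  wpoly j l (fun t => brace_lam (u t)^-1%g (v t)).
Proof.
move=> i_gt0 uR; move: {2}(k - j)%N (leqnn (k - j)) => d.
elim: d j l v => [|d IHd] j l v dj vP.
  have v0 : v =1 fun=> 0 by apply: wpoly_eq0 vP; rewrite -subn_eq0 -leqn0.
  by apply: (wpoly_ext (wpoly0 A j l)) => t; rewrite v0 linear0.
have uvP : wpoly (i + j) (n + l) (fun t => brace_lam (u t)^-1%g (brace_star (u t) (v t))).
  by apply: IHd (uR _ _ _ vP); lia.
apply: (wpoly_ext (wpolyB vP (wpolyW _ _ uvP))) => [||t]; rewrite ?leq_addl //.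
by rewrite -[X in X - _](brace_lamK (u t) (v t))
  (brace_lamE (u t) (v t)) linearD addrC addKr.
Qed.

(** With [w = lam g^-1 (u - g)] one has [u = g o w], and [w] has the same larger
    weight as [u - g].  An approximation of [u] up to weight [i + 1] is thus
    enough in the induction step. *)
Lemma raises_perturb i n u g : (0 < i)%N ->
    (forall w, wpoly i.+1 n w -> raises i.+1 n w) ->
    raises i n g -> wpoly i.+1 n (fun t => u t - g t) ->
  raises i n u.
Proof.
move=> i_gt0 IHi gR /(raises_lamV i_gt0 gR)/IHi.
move/(@raisesW _ _ i n _ (leqnSn _) (leqnn _)) => wR.
apply: (raises_ext (raisesM gR wR)) => t.
by rewrite -brace_mulVg_lam mulVKg.
Qed.

End Raises.

(** * Stability of weighted functions under star *)

Section PrimeField.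

Variables (p k : nat) (A : fBraceType 'F_p).
Hypotheses (p_prime : prime p) (ltkp : (k < p)%N).
Hypothesis Ak : forall x : A, strong_pow k x -> x = 0.
Implicit Types (x y : A) (u v w : 'F_p -> A).

(** The binomial coefficient ['C('X, r)] as a polynomial, for [r < p]. *)
Definition bin_poly r : {poly 'F_p} :=
  r`!%:R^-1 *: \prod_(q < r) ('X - (q : nat)%:R%:P).

Lemma natr_val_Fp (c : 'F_p) : (c : nat)%:R = c.
Proof. exact: natr_Zp. Qed.

Lemma natr_ffact (R : comNzRingType) n r :
  (n ^_ r)%:R = \prod_(q < r) (n%:R - (q : nat)%:R) :> R.
Proof.
elim: r => [|r IHr]; first by rewrite big_ord0.
rewrite ffactnSr natrM big_ord_recr IHr /=.
case: (leqP r n) => [/natrB -> //|ltnr].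
have ->: \prod_(i < r) (n%:R - (i : nat)%:R) = 0 :> R.
  by rewrite (bigD1 (Ordinal ltnr)) //= subrr mul0r.
by rewrite !mul0r.
Qed.

Lemma bin_polyE (c : 'F_p) r : (r < p)%N -> ('C(c, r))%:R = (bin_poly r).[c].
Proof.
move=> ltrp; rewrite /bin_poly hornerZ horner_prod.
have r_neq0 : r`!%:R != 0 :> 'F_p.
  rewrite -(dvdn_pcharf (pchar_Fp p_prime)).
  elim: r ltrp => [|r IHr] ltrp; first by rewrite dvdn1 neq_ltn prime_gt1 ?orbT.
  rewrite factS Euclid_dvdM // negb_or IHr ?(ltnW ltrp) // andbT.
  by rewrite gtnNdvd.
apply: (mulfI r_neq0); rewrite mulrA divff // mul1r -natrM mulnC bin_ffact.
rewrite natr_ffact natr_val_Fp; apply: eq_bigr => q _.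
by rewrite !hornerE.
Qed.

(** ['C(n, r)] is a combination of [n, n^2, .., n^r], without constant term as
    [0 < r]; for [n = t^m] only exponents between [m] and [m r] occur. *)
Lemma wpoly_bin i n l m r x : (0 < r < p)%N -> (n <= l + m)%N ->
  strong_pow i x -> strong_pow (l + m * r) x ->
  wpoly i n (fun t => t ^+ l *: (x *+ 'C((t ^+ m)%R : 'F_p, r))).
Proof.
case/andP=> r_gt0 ltrp nm xi xr.
have sz : (size (bin_poly r) <= r.+1)%N.
  apply: leq_trans (size_scale_leq _ _) _.
  by rewrite -(big_mkord xpredT (fun q => 'X - q%:R%:P)) size_prod_XsubC size_iota subn0.
have P0 : (bin_poly r)`_0 = 0.
  rewrite -horner_coef0 /bin_poly hornerZ horner_prod.
  by rewrite (bigD1 (Ordinal r_gt0)) //= hornerXsubC subrr mul0r mulr0.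
pose f (q : 'I_r.+1) t := t ^+ (l + m * q) *: ((bin_poly r)`_q *: x).
have fP q : wpoly i n (f q).
  have [q0|q_gt0] := posnP q.
    apply: (wpoly_ext (wpoly0 A i n)) => t.
    by rewrite /f q0 P0 scale0r scaler0.
  apply: wpoly_mono; [|exact: strong_powZ|apply/strong_powZ/(strong_powW _ xr)].
    by apply: leq_trans nm _; rewrite leq_add2l leq_pmulr.
  by rewrite leq_add2l leq_mul2l -ltnS ltn_ord orbT.
apply: (wpoly_ext (wpoly_sum (index_enum _) fP)) => t.
rewrite -scaler_nat bin_polyE // (horner_coef_wide _ sz) scalerA mulr_sumr scaler_suml.
by apply: eq_bigr => q _; rewrite /f scalerA exprD exprM mulrCA mulrC.
Qed.

Lemma big_ord_recl_pred (V : nmodType) n (f : nat -> V) : (0 < n)%N ->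
  \sum_(i < n) f i = f 0%N + \sum_(i < n.-1) f i.+1.
Proof. by case: n => // n _; rewrite big_ord_recl. Qed.

Lemma iter_brace_star_eq0 i x y : (0 < i)%N -> strong_pow i x ->
  iter k (brace_star x) y = 0.
Proof.
move=> i_gt0 xi; apply: Ak.
apply: strong_powW (strong_pow_iter_star k xi (_ : strong_pow 0 y)) => //.
by rewrite addn0 leq_pmulr.
Qed.

(** The circle power acts by [\sum_r 'C(t^m, r) (x * _)^r].  On a monomial
    [t^l y], with [y] in [A^[l]], the [r]-th term has degree at most [m r + l] in
    [t] and a coefficient of weight at least [i r + l]; hence [m <= i]. *)
Lemma raises_mulgX i m x : (0 < i)%N -> (m <= i)%N -> strong_pow i x ->
  raises i m (fun t => (x ^+ ((t ^+ m)%R : 'F_p))%g).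
Proof.
move=> i_gt0 mi xi; apply: raises_mono => l y j yj yl.
have [k0|k_gt0] := posnP k.
  apply: (wpoly_ext (wpoly0 A _ _)) => t; rewrite [RHS](Ak _) // k0 //.
pose f (r : 'I_k.-1) t :=
  t ^+ l *: (iter r.+1 (brace_star x) y *+ 'C((t ^+ m)%R : 'F_p, r.+1)).
have fP r : wpoly (i + j) (m + l) (f r).
  apply: wpoly_bin.
  - by have := ltn_ord r; lia.
  - by rewrite addnC.
  - by apply: strong_powW (strong_pow_iter_star r.+1 xi yj); nia.
  - by apply: strong_powW (strong_pow_iter_star r.+1 xi yl); nia.
apply: (wpoly_ext (wpoly_sum (index_enum _) fP)) => t.
rewrite linearZ -scaler_sumr /=; congr (_ *: _).
apply: (addIr y); rewrite -brace_lamE brace_lamX.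
rewrite (iter_brace_lam _ (iter_brace_star_eq0 y i_gt0 xi)).
rewrite (big_ord_recl_pred (fun r => iter r (brace_star x) y *+ 'C(_, r)) k_gt0).
by rewrite bin0 addrC.
Qed.

(** The term [r = 1] of [x^(o n) = \sum_r 'C(n, r) (x * _)^(r-1) x] is [n x];
    the others have weight at least [2 i]. *)
Lemma wpoly_mulgX i m x : (0 < i)%N -> (m <= i)%N -> strong_pow i x ->
  wpoly i.+1 m (fun t => t ^+ m *: x - (x ^+ ((t ^+ m)%R : 'F_p))%g).
Proof.
move=> i_gt0 mi xi.
have [k0|k_gt0] := posnP k.
  apply: (wpoly_ext (wpoly0 A _ _)) => t; rewrite [RHS](Ak _) // k0 //.
pose f (r : 'I_k.-1) t :=
  t ^+ 0 *: (iter r.+1 (brace_star x) x *+ 'C((t ^+ m)%R : 'F_p, r.+2)).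
have fP r : wpoly i.+1 m (f r).
  apply: wpoly_bin => //.
  - by have := ltn_ord r; lia.
  - by apply: strong_powW (strong_pow_iter_star r.+1 xi xi); nia.
  - by apply: strong_powW (strong_pow_iter_star r.+1 xi xi); nia.
apply: (wpoly_ext (wpolyN (wpoly_sum (index_enum _) fP))) => t.
rewrite (brace_expE _ (iter_brace_star_eq0 x i_gt0 xi)).
rewrite (big_ord_recl_pred (fun r => iter r (brace_star x) x *+ 'C(_, r.+1)) k_gt0).
rewrite bin1 -[in X in X - _](natr_val_Fp (t ^+ m)).
rewrite scaler_nat opprD addrA subrr add0r; congr (- _).
by apply: eq_bigr => r _; rewrite /f expr0 scale1r.
Qed.

(** Descending induction on [i]: the class of functions with this property
    contains the monomials, by comparison with circle powers, and is closed
    under addition, by comparison with the circle product. *)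
Lemma wpoly_raises i n u : (0 < i)%N -> wpoly i n u -> raises i n u.
Proof.
move: {2}(k - i)%N (leqnn (k - i)) => d.
elim: d i n u => [|d IHd] i n u di i_gt0 uP.
  move=> j l v vP; have u0 : u =1 fun=> 0.
    by apply: (wpoly_eq0 Ak) uP; rewrite -subn_eq0 -leqn0.
  by apply: (wpoly_ext (wpoly0 A _ _)) => t; rewrite u0 brace_star0l.
have [ki|ltik] := leqP k i; first by apply: IHd uP; lia.
have IHi n' w : wpoly i.+1 n' w -> raises i.+1 n' w by apply: IHd; lia.
elim: uP => [m x nm xi xm|v w vP IHv wP IHw|v w _ IHv Evw].
- apply: (@raisesW _ _ i m) => //.
  have [mi|ltim] := leqP m i.
    exact: (raises_perturb Ak i_gt0 (IHi m) (raises_mulgX i_gt0 mi xi)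
      (wpoly_mulgX i_gt0 mi xi)).
  have /IHi := wpoly_mono (leqnn m) (strong_powW ltim xm) xm.
  exact: raisesW.
- apply: (raises_perturb Ak i_gt0 (IHi n) (raisesM IHv IHw)).
  have := wpolyN (IHv _ _ _ wP).
  move/(@wpolyW _ _ _ _ i.+1 n) => H; apply: (wpoly_ext (H _ _)) => [||t]; try lia.
  by rewrite brace_mulB.
exact: raises_ext Evw.
Qed.

End PrimeField.

(** * The linear coefficient *)

Section LinearCoefficient.

Variables (p : nat) (A : fBraceType 'F_p).
Implicit Types (x y a b c : A) (u v w : 'F_p -> A).

(** The name is justified by [lin_coef_mono]. *)
Definition lin_coef u : A :=
  - \sum_(0 <= i < p.-1) (2 ^ i)%N%:R^-1 *: u (2 ^ i)%N%:R.

Lemma eq_lin_coef u v : u =1 v -> lin_coef u = lin_coef v.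
Proof.
by move=> Euv; rewrite /lin_coef; congr (- _); apply: eq_bigr => i _; rewrite Euv.
Qed.

Lemma lin_coefD u v : lin_coef (fun t => u t + v t) = lin_coef u + lin_coef v.
Proof.
by rewrite /lin_coef -opprD -big_split; congr (- _); apply: eq_bigr => i _;
  rewrite scalerDr.
Qed.

Lemma lin_coef_linear (f : A -> A) u : linear f ->
  lin_coef (fun t => f (u t)) = f (lin_coef u).
Proof.
move=> f_lin; pose g : {linear A -> A} :=
  HB.pack f (GRing.isLinear.Build 'F_p A A *:%R f f_lin).
rewrite /lin_coef -[RHS]/(g _) linearN [in RHS](linear_sum g); congr (- _).
by apply: eq_bigr => i _; rewrite [in RHS]linearZ.
Qed.

Lemma brace_odotE a b :
  brace_odot a b = lin_coef (fun t => brace_star (t *: a) b).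
Proof.
rewrite /brace_odot /brace_dot /lin_coef; congr (- _).
by apply: eq_bigr => i _; rewrite scaler_nat.
Qed.

Variable k : nat.
Hypotheses (p_prime : prime p) (lt2kp : (2 ^ k < p)%N) (k_gt0 : (0 < k)%N).
Hypothesis Ak : forall x : A, strong_pow k x -> x = 0.

Let two_neq0 : 2%:R != 0 :> 'F_p.
Proof.
rewrite -(dvdn_pcharf (pchar_Fp p_prime)) gtnNdvd //.
by apply: leq_ltn_trans lt2kp; rewrite (leq_pexp2l (m := 2) (n1 := 1)).
Qed.

(** Because [2^m - 1] lies strictly between 0 and [p]. *)
Lemma expr2_neq1 m : (0 < m <= k)%N -> 2%:R ^+ m != 1 :> 'F_p.
Proof.
case/andP=> m_gt0 lemk.
have lt1m : (1 < 2 ^ m)%N by rewrite -[1%N](expn0 2) ltn_exp2l.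
rewrite -natrX -subr_eq0 -(natrB _ (ltnW lt1m)) -(dvdn_pcharf (pchar_Fp p_prime)).
rewrite gtnNdvd ?subn_gt0 //; apply: leq_ltn_trans lt2kp.
by apply: leq_trans (leq_subr _ _) _; rewrite leq_pexp2l.
Qed.

Lemma geom_sum_eq0 (r : 'F_p) : r != 0 -> r != 1 -> \sum_(i < p.-1) r ^+ i = 0.
Proof.
move=> r0 r1; have : (r - 1) * (\sum_(i < p.-1) r ^+ i) = 0.
  rewrite -subrX1; apply/eqP; rewrite subr_eq0; apply/eqP/(mulfI r0).
  by have := expf_card r; rewrite card_Fp // -exprS prednK ?prime_gt0 // mulr1.
by move/eqP; rewrite mulf_eq0 subr_eq0 (negPf r1) => /eqP.
Qed.

(** Weights bound the exponent: for [m >= k] the coefficient [x] is zero, and for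
    [m < k] the ratio [2^(m-1)] of the geometric sum is 1 only if [m = 1]. *)
Lemma lin_coef_mono m x : strong_pow m x ->
  lin_coef (fun t => t ^+ m *: x) = x *+ (m == 1%N).
Proof.
move=> xm; have [kleqm|ltmk] := leqP k m.
  rewrite (Ak (strong_powW kleqm xm)) mul0rn /lin_coef big1 ?oppr0 // => i _.
  by rewrite !scaler0.
pose r : 'F_p := 2%:R ^+ m / 2%:R.
have -> : lin_coef (fun t => t ^+ m *: x) = - ((\sum_(i < p.-1) r ^+ i) *: x).
  rewrite /lin_coef big_mkord scaler_suml; congr (- _); apply: eq_bigr => i _.
  by rewrite scalerA natrX exprMn exprVn -!exprM mulrC [(m * i)%N]mulnC.
case: (eqVneq m 1%N) => [m1|m1].
  rewrite /r m1 expr1 divff // (eq_bigr (fun=> 1)) => [|i _]; last exact: expr1n.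
  rewrite sumr_const card_ord; have : p.-1.+1%:R = 0 :> 'F_p.
    by rewrite prednK ?prime_gt0 // pchar_Fp_0.
  rewrite -natr1 => /eqP; rewrite addr_eq0 => /eqP->.
  by rewrite scaleN1r opprK.
rewrite geom_sum_eq0 ?scale0r ?oppr0 ?(negPf m1) //.
  by rewrite mulf_neq0 ?expf_neq0 ?invr_eq0.
rewrite /r {r xm}; case: m m1 ltmk => [|[|m]] // _ ltmk.
  by rewrite expr0 mul1r invr_eq1; apply: (@expr2_neq1 1).
rewrite exprSr mulfK // expr2_neq1 //; lia.
Qed.

Lemma lin_coef_order2 i u : wpoly i 2 u -> lin_coef u = 0.
Proof.
elim=> [m x m2 _ xm|v w _ IHv _ IHw|v w _ IHv Evw].
- by rewrite lin_coef_mono // [m == _]gtn_eqF.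
- by rewrite lin_coefD IHv IHw addr0.
by rewrite -(eq_lin_coef Evw).
Qed.

Lemma wpoly_order2 i u :
  wpoly i 1 u -> wpoly i 2 (fun t => u t - t *: lin_coef u).
Proof.
elim=> [m x m1 xi xm|v w _ IHv _ IHw|v w _ IHv Evw].
- rewrite lin_coef_mono //.
  case: m m1 xm => [|[|m]] // _ xm.
    by apply: (wpoly_ext (wpoly0 A i 2)) => t; rewrite subrr.
  apply: (wpoly_ext (@wpoly_mono _ _ i 2 m.+2 x _ _ _)) => // t.
  by rewrite scaler0 subr0.
- apply: (wpoly_ext (wpolyD IHv IHw)) => t.
  by rewrite lin_coefD scalerDr opprD addrACA.
by apply: (wpoly_ext IHv) => t; rewrite -(eq_lin_coef Evw) Evw.
Qed.

Lemma wpoly_order1 i u : wpoly i 0 u -> wpoly i 1 (fun t => u t - u 0).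
Proof.
elim=> [m x _ xi xm|v w _ IHv _ IHw|v w _ IHv Evw].
- case: m xm => [|m] xm.
    by apply: (wpoly_ext (wpoly0 A i 1)) => t; rewrite subrr.
  apply: (wpoly_ext (@wpoly_mono _ _ i 1 m.+1 x _ _ _)) => // t.
  by rewrite expr0n scale0r subr0.
- by apply: (wpoly_ext (wpolyD IHv IHw)) => t; rewrite opprD addrACA.
by apply: (wpoly_ext IHv) => t; rewrite !Evw.
Qed.

Lemma wpoly_cst c : wpoly 1 0 (fun=> c).
Proof.
by apply: (wpoly_ext (@wpoly_mono _ A 1 0 0 c _ _ _)) => // t; rewrite scale1r.
Qed.

Lemma wpoly_line c : wpoly 1 1 (fun t => t *: c).
Proof. exact: (@wpoly_mono _ A 1 1 1 c). Qed.

Lemma lin_coef_line c : lin_coef (fun t => t *: c) = c.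
Proof. exact: (@lin_coef_mono 1). Qed.

Lemma lin_coef_cst c : lin_coef (fun=> c) = 0.
Proof.
rewrite -[RHS](@lin_coef_mono 0 c) //; apply: eq_lin_coef => t.
by rewrite scale1r.
Qed.

Let ltkp : (k < p)%N. Proof. exact: ltn_trans (ltn_expl k _) lt2kp. Qed.

Let wp_raises i n u : wpoly i.+1 n u -> raises i.+1 n u.
Proof. exact: (wpoly_raises p_prime ltkp Ak). Qed.

(** * First-order calculus and the pre-Lie identity *)

(** With [u + v = u o v o w], where [w] has order 2 as [u * v] has, expanding
    [(u o v o w) * c] gives [u * c + v * c] plus terms of order 2. *)
Lemma lin_coef_starDl u v c : wpoly 1 1 u -> wpoly 1 1 v ->
  lin_coef (fun t => brace_star (u t + v t) c) =
  lin_coef (fun t => brace_star (u t) c) + lin_coef (fun t => brace_star (v t) c).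
Proof.
move=> uP vP; have uR := wp_raises uP; have vR := wp_raises vP.
have cP := wpoly_cst c.
pose w t := ((u t * v t)^-1 * (u t + v t))%g.
have wP : wpoly 2 2 w.
  apply: (wpoly_ext (raises_lamV Ak _ (raisesM uR vR) (wpolyN (uR _ _ _ vP)))) => // t.
  by rewrite /w brace_mulVg_lam brace_mulB.
have wR := wp_raises wP.
pose r t := brace_star (u t) (brace_star (v t) c)
  + (brace_star (u t * v t)%g (brace_star (w t) c) + brace_star (w t) c).
have rP : wpoly 0 2 r.
  apply: wpolyD; first exact: wpolyW (uR _ _ _ (vR _ _ _ cP)).
  apply: wpolyD; last exact: wpolyW (wR _ _ _ cP).
  exact: wpolyW (raisesM uR vR (wR _ _ _ cP)).
rewrite -lin_coefD -[RHS]addr0 -[X in _ = _ + X](lin_coef_order2 rP) -lin_coefD.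
apply: eq_lin_coef => t.
rewrite -[X in brace_star X c](mulVKg (u t * v t)%g) -/(w t) brace_starM.
rewrite (brace_starM (u t) (v t) c) /r addrAC addrC.
by rewrite -(addrA (brace_star (u t) (brace_star _ _))) -[LHS]addrA addrCA.
Qed.

Lemma brace_odotDl c : {morph (fun a => brace_odot a c) : a b / a + b}.
Proof.
move=> a b; rewrite !brace_odotE -lin_coef_starDl; try exact: wpoly_line.
by apply: eq_lin_coef => t; rewrite scalerDr.
Qed.

Lemma brace_odot0l c : brace_odot 0 c = 0.
Proof.
rewrite brace_odotE -[RHS](lin_coef_cst 0); apply: eq_lin_coef => t.
by rewrite scaler0 brace_star0l.
Qed.

(** Additivity suffices over a prime field. *)
Lemma brace_odotZl (d : 'F_p) a c : brace_odot (d *: a) c = d *: brace_odot a c.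
Proof.
rewrite -(natr_val_Fp d) !scaler_nat.
by elim: (d : nat) => [|n IHn]; rewrite ?brace_odot0l // !mulrS brace_odotDl IHn.
Qed.

Lemma brace_odot_linear_l c : linear (fun a => brace_odot a c).
Proof. by move=> d a b; rewrite brace_odotDl brace_odotZl. Qed.

Lemma brace_odot_linear_r a : linear (brace_odot a).
Proof.
move=> d x y; rewrite !brace_odotE.
rewrite -(lin_coef_linear _ (linearP ( *:%R d))) -lin_coefD.
by apply: eq_lin_coef => t; rewrite linearP.
Qed.

HB.instance Definition _ a :=
  GRing.isLinear.Build 'F_p A A *:%R (brace_odot a) (brace_odot_linear_r a).

(** Chain rule: [t |-> u t * c] depends to first order only on the linear part
    of [u]. *)
Lemma lin_coef_star_cst u c : wpoly 1 1 u ->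
  lin_coef (fun t => brace_star (u t) c) = brace_odot (lin_coef u) c.
Proof.
move=> uP; have rP := wpoly_order2 uP.
have r1P : wpoly 1 1 (fun t => u t - t *: lin_coef u) by apply: wpolyW rP.
have := lin_coef_starDl c (wpoly_line (lin_coef u)) r1P.
rewrite (lin_coef_order2 (wp_raises rP (wpoly_cst c))) addr0 -brace_odotE => <-.
by apply: eq_lin_coef => t; rewrite addrC subrK.
Qed.

(** Product rule, in the case where [u] has no constant term. *)
Lemma lin_coef_star i u v : wpoly 1 1 u -> wpoly i 0 v ->
  lin_coef (fun t => brace_star (u t) (v t)) = brace_odot (lin_coef u) (v 0).
Proof.
move=> uP vP; rewrite -lin_coef_star_cst // -[RHS]addr0.
rewrite -(lin_coef_order2 (wp_raises uP (wpoly_order1 vP))) -lin_coefD.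
by apply: eq_lin_coef => t; rewrite -linearD /= addrC subrK.
Qed.

(** Infinitesimal form of [lam (s a) o lam b = lam b o lam (b^-1 o (s a) o b)]: the
    conjugate of [s a] by [b] is [lam b^-1 (s a + (s a) * b)]. *)
Lemma brace_odot_conj a b c :
  brace_odot a (brace_lam b c) =
  brace_lam b (brace_odot (brace_lam b^-1%g (a + brace_odot a b)) c).
Proof.
pose v t := t *: a + brace_star (t *: a) b.
pose w t := brace_lam b^-1%g (v t).
have vP : wpoly 1 1 v.
  apply: wpolyD (wpoly_line a) _.
  exact: wpolyW (wp_raises (wpoly_line a) (wpoly_cst b)).
have wP : wpoly 1 1 w by exact: (raises_lamV Ak _ (wp_raises (wpoly_cst b)) vP).
have lin_w : lin_coef w = brace_lam b^-1%g (a + brace_odot a b).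
  rewrite lin_coef_linear; last exact: linearP.
  by rewrite lin_coefD -brace_odotE lin_coef_line.
rewrite -lin_w -lin_coef_star_cst //.
rewrite -(lin_coef_linear _ (linearP (brace_lam b))) brace_odotE.
apply: eq_lin_coef => t; apply: (addIr (brace_lam b c)).
rewrite -brace_lamE -linearD -brace_lamE /= -!brace_lamM; congr (brace_lam _ c).
rewrite -[LHS](mulVKg b) brace_mulVg_lam; congr (b * brace_lam _ _)%g.
by rewrite brace_mulE brace_lamE addrA addrK.
Qed.

Lemma wpoly_odot i n u c : wpoly i n u -> wpoly i n (fun t => brace_odot (u t) c).
Proof.
have odotW j x : strong_pow j x -> strong_pow j (brace_odot x c).
  move=> xj; rewrite /brace_odot -scaleN1r; apply/strong_powZ/strong_pow_sum => l _.
  rewrite -scaler_nat; apply/strong_powZ.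
  apply: strong_powW (strong_pow_star (strong_powZ _ xj) (_ : strong_pow 0 c)) => //.
  by rewrite addn0.
elim=> [m x nm xi xm|v w _ IHv _ IHw|v w _ IHv Evw].
- by apply: (wpoly_ext (wpoly_mono nm (odotW _ _ xi) (odotW _ _ xm))) => t;
    rewrite brace_odotZl.
- by apply: (wpoly_ext (wpolyD IHv IHw)) => t; rewrite brace_odotDl.
by apply: (wpoly_ext IHv) => t; rewrite Evw.
Qed.

(** Linear coefficient in [t] of [brace_odot_conj] for [t b] in place of [b].  With
    [w t = lam (t b)^-1 (a + t (a (.) b))], the equation
    [w + (t b) * w = a + t (a (.) b)] gives [w 0 = a] and the linear coefficient
    [a (.) b - b (.) a] of [w]. *)
Lemma brace_odot_assoc a b c :
  brace_odot a (brace_odot b c) =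
  brace_odot b (brace_odot a c) + brace_odot (brace_odot a b - brace_odot b a) c.
Proof.
pose w t := brace_lam (t *: b)^-1%g (a + t *: brace_odot a b).
have bP := wpoly_line b; have bR := wp_raises bP.
have wP : wpoly 1 0 w.
  apply: (raises_lamV Ak _ bR) => //; apply: wpolyD (wpoly_cst a) _.
  exact: wpolyW (wpoly_line _).
have w0 : w 0 = a.
  by rewrite /w !scale0r addr0 -brace1 invg1 brace_lam1.
have lin_w : lin_coef w = brace_odot a b - brace_odot b a.
  apply/(canRL (addrK _)); rewrite addrC -[X in brace_odot _ X]w0.
  rewrite -{1}(lin_coef_line b) -(lin_coef_star bP wP) -lin_coefD.
  rewrite -[RHS]lin_coef_line -[RHS]add0r -(lin_coef_cst a) -lin_coefD.
  by apply: eq_lin_coef => t; rewrite -brace_lamE /w brace_lamVK.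
pose f t := brace_lam (t *: b) (brace_odot (w t) c).
have <- : lin_coef f = brace_odot a (brace_odot b c).
  rewrite [in RHS](brace_odotE b) -(lin_coef_linear _ (brace_odot_linear_r a)).
  rewrite -[RHS]addr0 -(lin_coef_cst (brace_odot a c)) -lin_coefD.
  apply: eq_lin_coef => t; rewrite /f /w -[t *: brace_odot a b]linearZ.
  by rewrite -brace_odot_conj brace_lamE linearD.
rewrite (eq_lin_coef (fun t => brace_lamE _ _)) lin_coefD.
rewrite (lin_coef_star bP (wpoly_odot c wP)) lin_coef_line w0.
by rewrite (lin_coef_linear _ (brace_odot_linear_l c)) lin_w.
Qed.

End LinearCoefficient.

Theorem corollary6 (p k : nat) (A : fBraceType 'F_p) :
  prime p -> (2 ^ k < p)%N -> strongly_nilpotent_of_degree A k ->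
  @pre_lie_algebra 'F_p A (@brace_odot p A).
Proof.
move=> p_prime lt2kp [k_gt0 Ak0 _].
have Ak (x : A) : strong_pow k x -> x = 0 by move/Ak0.
split=> [y|x|x y z].
- exact: (brace_odot_linear_l p_prime lt2kp k_gt0 Ak).
- exact: brace_odot_linear_r.
have odotB u v : brace_odot (u - v) z = brace_odot u z - brace_odot v z.
  by apply/(canRL (addrK _)); rewrite -(brace_odotDl p_prime lt2kp k_gt0 Ak) subrK.
rewrite (brace_odot_assoc p_prime lt2kp k_gt0 Ak x y z) odotB.
by rewrite opprD opprB addrCA [X in _ + X]addrC subrK addrC.
Qed.
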